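(* There exist absolute constants $c_*>0$ and $K>0$ such that for every finite abelian group $\mathbf{G}$ of order $N$, the number $T(\mathbf{G})$ of ordered triples $(A,B,C)$ of subsets of $\mathbf{G}$ such that $x+y\neq z$ for all $x\in A$, $y\in B$, $z\in C$ satisfies $$\bigl|T(\mathbf{G})-3\cdot 4^N-3N\cdot 3^N\bigr|\leqslant K(3-c_* )^N .$$
   Context: The subsets $A,B,C$ may be empty. *)

(* Defs.v *)
From HB Require Import structures.
From mathcomp Require Import all_boot all_order all_algebra.
From mathcomp Require Import all_classical all_reals.
Set Implicit Arguments. Unset Strict Implicit. Unset Printing Implicit Defensive.
Import Order.TTheory GRing.Theory Num.Theory.
Local Open Scope ring_scope.

Definition triple_count (G : finZmodType) : nat :=
  #|[set t : {set G} * {set G} * {set G} |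
      [forall x in t.1.1, forall y in t.1.2, forall z in t.2, x + y != z]]|.

(* Main.v *)
(** Replacing C by -C makes the condition symmetric: x + y + z is never 0.
    Triples with a member of size at most 1 give 3 * 4^N + 3 * N * 3^N, up to
    the double counting of triples with two such members, which is
    exponentially smaller than 3^N.

    If A contains two points that differ by t, choose a set M disjoint from
    M + t with 3 |M| >= N.  Up to translation and sign, B and C give each point
    of G one of three states, and each pair {y, y + t} with y in M has only
    8 joint states instead of 9.  So there are at most 24^(N/3) pairs (B, C),
    and the sets A of size between 2 and a constant d cost little.

    If |A|, |B|, |C| >= d, fix a d-subset S of B.  The pairs (A, C) are
    independent sets of a d-regular bipartite Cayley graph, and a subset T of A
    of size at most N / phi determines containers A' of A and C' of C with
    |A'| + |C'| at most (1 + 1/Q) N.  Doing this for the three pairs bounds the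
    total size of the containers by 3/2 (1 + 1/Q) N, and 2^(3/2) < 3. *)
Require Import Defs.
From HB Require Import structures.
From mathcomp Require Import all_boot all_order all_algebra.
From mathcomp Require Import all_classical all_reals.
From mathcomp Require Import zify ring lra.
Set Implicit Arguments. Unset Strict Implicit. Unset Printing Implicit Defensive.
Import Order.TTheory GRing.Theory Num.Theory.
Local Open Scope nat_scope.

(** * Counting small subsets *)

Lemma sum_expn_cardC (T : finType) m :
  \sum_(B : {set T}) m ^ #|~: B| = m.+1 ^ #|T|.
Proof.
have -> : m.+1 ^ #|T| = \prod_(i : T) (1 + m) by rewrite prod_nat_const.
rewrite bigA_distr.
apply: eq_big => // B _.
rewrite -prod_nat_const big_mkcond; apply: eq_bigr => i _.
by rewrite inE; case: (i \in B).
Qed.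

(* Weigh each B by m ^ (#|T| - #|B|), which is at least m ^ (#|T| - k) when B is small. *)
Lemma card_small_sets (T : finType) m k : 0 < m ->
  #|[set B : {set T} | #|B| <= k]| * m ^ #|T| <= m ^ k * m.+1 ^ #|T|.
Proof.
move=> m_gt0; rewrite -sum_expn_cardC -sum_nat_const big_distrr /=.
rewrite [X in X <= _]big_mkcond; apply: leq_sum => B _; rewrite inE.
case: ifP => // Bk; rewrite -expnD leq_pexp2l //.
by rewrite -(cardsC B) leq_add2r.
Qed.

(** * The symmetric form of the problem *)

Definition negsum (G : finZmodType) (A B : {set G}) : {set G} :=
  [set (- (x + y))%R | x in A, y in B].

(** As a disjointness, so that the C compatible with A and B are the subsets of one complement. *)
Definition zsf (G : finZmodType) (A B C : {set G}) : bool :=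
  [disjoint negsum A B & C].

Lemma zsfP (G : finZmodType) (A B C : {set G}) :
  reflect {in A & B, forall x y, {in C, forall z, (x + y + z)%R != 0%R}}
          (zsf A B C).
Proof.
rewrite /zsf disjoint_subset; apply: (iffP fintype.subsetP) => [sub x y Ax By z Cz | neq0 w].
  apply: contraTneq Cz => /eqP; rewrite addrC addr_eq0 => /eqP ->.
  by have := sub _ (imset2_f _ Ax By); rewrite inE.
case/imset2P=> x y Ax By ->; rewrite inE.
by apply/negP => /(neq0 _ _ Ax By)/eqP; apply; rewrite addrN.
Qed.

Lemma zsfC12 (G : finZmodType) (A B C : {set G}) : zsf A B C = zsf B A C.
Proof. by apply/zsfP/zsfP => H x y Ax By z Cz; rewrite (addrC x) H. Qed.

Lemma zsfC23 (G : finZmodType) (A B C : {set G}) : zsf A B C = zsf A C B.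
Proof. by apply/zsfP/zsfP => H x y Ax By z Cz; rewrite addrAC H. Qed.

Lemma triple_countE (G : finZmodType) :
  triple_count G =
  \sum_(A : {set G}) \sum_(B : {set G}) \sum_(C : {set G}) zsf A B C.
Proof.
rewrite /triple_count -sum1dep_card big_mkcond /= pair_bigA pair_bigA /=.
have negK : involutive (fun C : {set G} => [set - z | z in C]%R).
  by move=> C; rewrite -imset_comp (eq_imset _ (@opprK G)) imset_id.
rewrite (reindex_inj (h := fun t : {set G} * {set G} * {set G} =>
  (t.1, [set - z | z in t.2]%R))) /=; last first.
  by move=> [p C] [q D] /= [-> /(inv_inj negK) ->].
apply: eq_bigr => -[[A B] C] _ /=.
have -> : zsf A B C =
    [forall x in A, forall y in B, forall z in [set - z | z in C]%R, x + y != z]%R.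
  apply/zsfP/forall_inP => [H x Ax | H x y Ax By z Cz].
    apply/forall_inP => y By; apply/forall_inP => _ /imsetP[z Cz ->].
    by rewrite -subr_eq0 opprK H.
  move/forall_inP: (H x Ax) => /(_ y By)/forall_inP/(_ (- z)%R).
  by rewrite -subr_eq0 opprK; apply; rewrite imset_f.
by case: ifP.
Qed.

(** * Pairs (B, C) compatible with a given A *)

Definition link (G : finZmodType) (A : {set G}) : nat :=
  \sum_(B : {set G}) \sum_(C : {set G}) zsf A B C.

Lemma sum_disjoint (T : finType) (D : {set T}) :
  \sum_(C : {set T}) [disjoint D & C] = 2 ^ #|~: D|.
Proof.
rewrite -card_powerset -sum1_card [RHS]big_mkcond; apply: eq_bigr => C _.
by rewrite powersetE -finset.disjoints_subset disjoint_sym; case: ifP.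
Qed.

Lemma linkE (G : finZmodType) (A : {set G}) :
  link A = \sum_(B : {set G}) 2 ^ #|~: negsum A B|.
Proof. by apply: eq_bigr => B _; rewrite -sum_disjoint. Qed.

Lemma linkS (G : finZmodType) (A A' : {set G}) : A \subset A' -> link A' <= link A.
Proof.
move=> sAA'; apply: leq_sum => B _; apply: leq_sum => C _.
case: (boolP (zsf A' B C)) => // /zsfP H; suff -> : zsf A B C by [].
by apply/zsfP => x y /(fintype.subsetP sAA'); apply: H.
Qed.

Lemma link0 (G : finZmodType) : link (finset.set0 : {set G}) = 4 ^ #|G|.
Proof.
rewrite linkE (eq_bigr (fun=> 2 ^ #|G|)) => [|B _].
  by rewrite sum_nat_const -cardsT -finset.powersetT card_powerset cardsT -expnMn.
suff -> : negsum finset.set0 B = finset.set0 by rewrite finset.setC0 cardsT.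
by apply/setP => w; rewrite inE; apply/imset2P => -[x y]; rewrite inE.
Qed.

(** A singleton forbids exactly |B| points to C, which leaves the sum of 2^(N - |B|) over B. *)
Lemma link1 (G : finZmodType) (x : G) : link [set x] = 3 ^ #|G|.
Proof.
rewrite linkE -(sum_expn_cardC G 2); apply: eq_bigr => B _; congr (2 ^ _).
apply: (@addnI #|B|); rewrite cardsC -[RHS](cardsC (negsum [set x] B)).
congr (_ + _); rewrite /negsum imset2_set1l card_imset //.
by move=> y z /oppr_inj /addrI.
Qed.

Lemma sum_link_small (G : finZmodType) :
  \sum_(A : {set G} | #|A| <= 1) link A = 4 ^ #|G| + #|G| * 3 ^ #|G|.
Proof.
rewrite (bigD1 finset.set0) ?cards0 //= link0; congr (_ + _).
rewrite -(@sum_nat_const G predT).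
rewrite (eq_bigl (mem [set [set x] | x : G])) => [|A]; last first.
  apply/andP/imsetP => [[A1 A0]|[x _ ->]]; last first.
    by rewrite cards1; split=> //; apply/set0Pn; exists x; rewrite set11.
  have /cards1P[x ->] : #|A| == 1 by rewrite eqn_leq A1 card_gt0.
  by exists x.
rewrite big_imset /=; last by move=> x y _ _; apply: set1_inj.
by apply: eq_bigr => x _; rewrite link1.
Qed.

(** For an inclusion-maximal M, any point outside M, M + t and M - t could be added, so these three
    sets cover G. *)
Lemma shift_matching (G : finZmodType) (t : G) : t != 0%R ->
  exists2 M : {set G}, {in M, forall y, (y + t)%R \notin M} & #|G| <= 3 * #|M|.
Proof.
move=> t0; pose P (M : {set G}) := [forall y in M, (y + t)%R \notin M].
have [M /maxsetP[/forall_inP PM maxM]] : {M | maxset P M}.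
  by apply: ex_maxset; exists finset.set0; apply/forall_inP => y; rewrite inE.
exists M => //.
pose sh (s : G) := [set (y + s)%R | y in M].
have cardsh s : #|sh s| = #|M| by apply: card_imset; apply: addIr.
suff cover : [set: G] \subset M :|: (sh t :|: sh (- t)%R).
  rewrite -cardsT (leq_trans (subset_leq_card cover)) //.
  rewrite (leq_trans (leq_card_setU _ _)) // (leq_trans (leq_add (leqnn _) (leq_card_setU _ _))) //.
  by rewrite !cardsh; lia.
apply/fintype.subsetP => v _; rewrite !inE; case: (boolP (v \in M)) => //= vM.
case: (boolP (v \in sh t)) => //= vt.
case: (boolP (v \in sh (- t)%R)) => //= vt'.
suff /maxM : P (v |: M).
  by move=> /(_ (subsetU1 _ _)) E; rewrite -E setU11 in vM.
apply/forall_inP => y; rewrite !inE => /orP[/eqP->|yM].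
  rewrite negb_or -subr_eq0 addrAC subrr add0r t0 /=.
  by apply: contra vt' => H; apply/imsetP; exists (v + t)%R; rewrite ?addrK.
rewrite negb_or PM // andbT.
by apply: contra vt => /eqP <-; apply/imsetP; exists y.
Qed.

Lemma card_bool4 (F : pred ((bool * bool) * (bool * bool))) :
  #|F| = \sum_a \sum_b \sum_c \sum_d F (a, b, (c, d)).
Proof.
rewrite pair_bigA (eq_bigr (fun u => \sum_v F (u, v))) => [|[a b] _]; last first.
  by rewrite pair_bigA; apply: eq_bigr => -[c d].
rewrite pair_bigA -sum1_card big_mkcond; apply: eq_bigr => -[u v] _ /=.
by rewrite unfold_in; case: (F _).
Qed.

(** The joint states number at most 8^|M| 3^(N - 2|M|) = 3^N (8/9)^|M|, and 3|M| >= N. Cubing avoids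
    the cube root of 24. *)
Lemma link2 (G : finZmodType) (x x' : G) : x != x' ->
  link [set x; x'] ^ 3 <= 24 ^ #|G|.
Proof.
move=> xx'; have t0 : (x' - x)%R != 0%R by rewrite subr_eq0 eq_sym.
set t := (x' - x)%R in t0; have [M PM leM] := shift_matching t0.
(* [c p y] says that y lies in the translated reflection -x - C of C = p.2. *)
pose c (p : {set G} * {set G}) y := (- (x + y))%R \in p.2.
pose st (p : {set G} * {set G}) (y : G) := (y \in p.1, c p y).
(* The data at y + t is stored at y when y is in M, and the slot y + t is left blank. *)
pose enc p : {ffun G -> (bool * bool) * (bool * bool)} := [ffun y =>
  if y \in M then (st p y, st p (y + t)%R)
  else if (y - t)%R \in M then ((false, false), (false, false))
  else (st p y, (false, false))].
(* The last clause is the constraint from x': since x' + y = x + (y + t), y in B excludes y + t from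
   -x - C. It removes one of the nine states. *)
pose F8 : pred ((bool * bool) * (bool * bool)) := fun w =>
  [&& ~~ (w.1.1 && w.1.2), ~~ (w.2.1 && w.2.2) & ~~ (w.1.1 && w.2.2)].
pose F3 : pred ((bool * bool) * (bool * bool)) := fun w =>
  ~~ (w.1.1 && w.1.2) && (w.2 == (false, false)).
pose F (y : G) : pred ((bool * bool) * (bool * bool)) := fun w =>
  if y \in M then F8 w
  else if (y - t)%R \in M then w == ((false, false), (false, false)) else F3 w.
pose D := [set p : {set G} * {set G} | zsf [set x; x'] p.1 p.2].
have -> : link [set x; x'] = #|D|.
  rewrite /link pair_bigA -sum1dep_card [RHS]big_mkcond /=.
  by apply: eq_bigr => p _; case: zsf.
have encI : injective enc.
  move=> p q /ffunP E.
  have stE y : st p y = st q y.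
    rewrite /st.
    case: (boolP (y \in M)) => [yM|yM].
      by have := E y; rewrite !ffunE yM => -[-> -> _ _].
    case: (boolP ((y - t)%R \in M)) => ytM.
      by have := E (y - t)%R; rewrite !ffunE ytM subrK => -[_ _ -> ->].
    by have := E y; rewrite !ffunE (negbTE yM) (negbTE ytM) => -[-> ->].
  case: p q {E} stE => [B C] [B' C'] stE; congr (_, _); apply/setP => y.
    by have /(congr1 fst) := stE y.
  have /(congr1 snd) := stE (- (x + y))%R; rewrite /st /c /=.
  by rewrite opprD opprK addKr.
have subF : enc @: D \subset (family F : simpl_pred _).
  apply/fintype.subsetP => _ /imsetP[p pD ->]; move: pD; rewrite inE => /zsfP H.
  have H1 y : ~~ ((y \in p.1) && c p y).
    apply/negP => /andP[yB yC]; have := H x y (set21 _ _) yB _ yC.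
    by rewrite subrr eqxx.
  have H2 y : ~~ ((y \in p.1) && c p (y + t)%R).
    apply/negP => /andP[yB yC]; have := H x' y (set22 _ _) yB _ yC.
    rewrite /t [(y + _)%R]addrC addrA (addrC x) subrK.
    by rewrite subrr eqxx.
  apply/familyP => y; change (F y (enc p y)); rewrite ffunE /F.
  case: (y \in M); first by rewrite /F8 /st /= !H1 H2.
  by case: ((y - t)%R \in M); rewrite // /F3 /st /= H1.

have cF8 : #|F8| = 8.
  by rewrite card_bool4 !big_bool.
have cF3 : #|F3| = 3.
  by rewrite card_bool4 !big_bool.
(* The slots have 8 states on M, 1 on M + t and 3 elsewhere; the extra powers of 3 make one formula
   of this without division. *)
have cF y : #|F y| * (3 ^ (y \in M) * 3 ^ ((y - t)%R \in M)) = 8 ^ (y \in M) * 3.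
  rewrite /F; case: (boolP (y \in M)) => [yM|yM].
    have -> : (y - t)%R \in M = false.
      by apply/negP => /PM; rewrite subrK yM.
    by rewrite cF8.
  case: ((y - t)%R \in M); last by rewrite cF3.
  by rewrite card1.
have prodM (k : nat) (g : G -> G) : injective g ->
    \prod_(y : G) k ^ (g y \in M) = k ^ #|M|.
  move=> gI; rewrite -(card_preimset M gI) -prod_nat_const [RHS]big_mkcond.
  by apply: eq_bigr => y _; rewrite inE; case: (g y \in M).
have cD : #|D| <= \prod_(y : G) #|F y|.
  rewrite -(card_imset _ encI) (leq_trans (subset_leq_card subF)) //.
  by rewrite card_family foldrE big_map big_enum.
have E : (\prod_(y : G) #|F y|) * (3 ^ #|M| * 3 ^ #|M|) = 8 ^ #|M| * 3 ^ #|G|.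
  rewrite -{1}(prodM 3 id (@inj_id _)) -(prodM 3 (fun y => y - t)%R (addIr _)).
  rewrite -(prodM 8 id (@inj_id _)) -(@prod_nat_const G predT) -!big_split.
  by apply: eq_bigr => y _; apply: cF.
apply: leq_trans (_ : (\prod_(y : G) #|F y|) ^ 3 <= _).
  by rewrite leq_exp2r.
move: (\prod_(y : G) #|F y|) E => P E.
rewrite -(@leq_pmul2r (9 ^ (3 * #|M|))) ?expn_gt0 //.
have -> : P ^ 3 * 9 ^ (3 * #|M|) = 8 ^ (3 * #|M|) * 27 ^ #|G|.
  rewrite mulnC [3 * _]mulnC !expnM -expnMn mulnC (expnMn 3 3) E expnMn.
  by rewrite -[in RHS](expnM 3 3) (mulnC 3 #|G|) expnM.
rewrite -(subnK leM) !expnD (expnMn 3 8) (expnMn 3 9 #|G|).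
set k := 3 * #|M| - #|G|.
have le89 : 8 ^ k <= 9 ^ k by case: k => // k; rewrite leq_exp2r.
rewrite [X in X <= _](_ : _ = 8 ^ k * (8 ^ #|G| * 3 ^ #|G| * 9 ^ #|G|)); last by ring.
rewrite [X in _ <= X](_ : _ = 9 ^ k * (8 ^ #|G| * 3 ^ #|G| * 9 ^ #|G|)); last by ring.
by rewrite leq_mul.
Qed.

(** * Fingerprints and containers *)

Lemma negsum1 (G : finZmodType) (v : G) (S : {set G}) :
  negsum [set v] S = [set (- (v + s))%R | s in S].
Proof. exact: imset2_set1l. Qed.

Lemma negsumU1 (G : finZmodType) (v : G) (T S : {set G}) :
  negsum (v |: T) S = negsum [set v] S :|: negsum T S.
Proof. exact: imset2Ul. Qed.

Lemma negsumSl (G : finZmodType) (T A S : {set G}) :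
  T \subset A -> negsum T S \subset negsum A S.
Proof. exact: imset2Sl. Qed.

(* The container of A: the points with fewer than phi neighbours (through S)
   outside the neighbourhood of the fingerprint T. *)
Definition nearcover (G : finZmodType) phi (S T : {set G}) : {set G} :=
  [set v | #|negsum [set v] S :\: negsum T S| < phi].

(** Take T maximal among the subsets of A with at least phi |T| neighbours. A point of A with phi
    new neighbours could be added to T. *)
Lemma fingerprint (G : finZmodType) phi (A S C : {set G}) :
  0 < phi -> zsf A S C ->
  exists T : {set G}, [/\ phi * #|T| <= #|G|, A \subset nearcover phi S T &
                          C \subset ~: negsum T S].
Proof.
move=> phi0 zAC; pose P (T : {set G}) := (T \subset A) && (phi * #|T| <= #|negsum T S|).
have [T /maxsetP[/andP[sTA cT] maxT]] : {T | maxset P T}.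
  by apply: ex_maxset; exists finset.set0; rewrite /P finset.sub0set cards0 muln0.
exists T; split.
- exact: leq_trans cT (max_card _).
- apply/fintype.subsetP => v vA; rewrite inE ltnNge; apply/negP => le_phi.
  have vT : v \notin T.
    apply: contraL le_phi => vT; rewrite -ltnNge (_ : _ :\: _ = finset.set0) ?cards0 //.
    by apply/eqP; rewrite finset.setD_eq0 negsumSl // finset.sub1set.
  suff /maxT : P (v |: T) by move=> /(_ (subsetU1 _ _)) E; rewrite -E setU11 in vT.
  rewrite /P finset.subUset finset.sub1set vA sTA /= cardsU1 vT mulnDr muln1 negsumU1.
  rewrite cardsU -addnBAC ?subset_leq_card ?finset.subsetIl //.
  by rewrite -cardsD leq_add.
- rewrite -finset.disjoints_subset disjoint_sym.
  exact: disjointWl (negsumSl S sTA) zAC.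
Qed.

(** Each point of the first container sends more than Q phi of its (Q + 1) phi edges into D, and
    each point of D has degree (Q + 1) phi. So Q times that container is at most (Q + 1) |D|. *)
Lemma container_size (G : finZmodType) Q phi (S T : {set G}) :
  0 < phi -> #|S| = Q.+1 * phi ->
  Q * (#|nearcover phi S T| + #|~: negsum T S|) <= Q.+1 * #|G|.
Proof.
move=> phi0 cS; set D := negsum T S.
have card1 v : #|negsum [set v] S| = #|S|.
  by rewrite negsum1 card_imset // => a b /oppr_inj/addrI.
(* Double counting of the edges between G and D. *)
have dc : \sum_(v : G) #|negsum [set v] S :&: D| = #|D| * #|S|.
  rewrite -sum_nat_const.
  transitivity (\sum_(v : G) \sum_(w in D) (w \in negsum [set v] S)).
    apply: eq_bigr => v _; rewrite -sum1_card big_mkcond [RHS]big_mkcond.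
    by apply: eq_bigr => w _; rewrite inE andbC; do 2!case: (_ \in _).
  rewrite exchange_big; apply: eq_bigr => w _.
  rewrite -(card1 w) -sum1_card [RHS]big_mkcond; apply: eq_bigr => v _.
  have sym a b : (a \in negsum [set b] S) -> b \in negsum [set a] S.
    rewrite !negsum1 => /imsetP[s sS ->]; apply/imsetP; exists s => //.
    by rewrite opprD opprK addrK.
  have -> : (w \in negsum [set v] S) = (v \in negsum [set w] S).
    by apply/idP/idP; apply: sym.
  by case: (_ \in _).
have lb : #|nearcover phi S T| * (Q * phi) <= #|D| * #|S|.
  rewrite -dc -sum_nat_const big_mkcond; apply: leq_sum => v _.
  case: ifP => //; rewrite inE -/D => lt_phi.
  rewrite -(leq_add2l phi) -mulSn -cS -(card1 v) -(cardsID D (negsum [set v] S)).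
  by rewrite addnC leq_add2r ltnW.
rewrite cS [X in X <= _]mulnA mulnA leq_pmul2r // in lb.
rewrite -(cardsC D) !mulnDr; apply: leq_add; first by rewrite mulnC (mulnC Q.+1).
by rewrite leq_mul2r leqnSn orbT.
Qed.

Lemma leq_card_bigcup_const (I T : finType) (P : {set I}) (X : I -> {set T}) M :
  {in P, forall i, #|X i| <= M} -> #|\bigcup_(i in P) X i| <= #|P| * M.
Proof.
move=> leM; rewrite -sum_nat_const.
elim/big_ind2: _ => [|A a B b leA leB|i /leM //]; first by rewrite cards0.
by rewrite (leq_trans (leq_card_setU _ _)) ?leq_add.
Qed.

Lemma exists_subset_card (T : finType) (A : {set T}) d :
  d <= #|A| -> exists2 S : {set T}, S \subset A & #|S| = d.
Proof.
case/card_geqP=> s [us ss sA]; exists [set x in s].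
  by apply/fintype.subsetP => x; rewrite inE; apply: sA.
by rewrite cardsE (card_uniqP us).
Qed.

Lemma card_large_triples (G : finZmodType) Q phi d :
  0 < Q -> 0 < phi -> d = Q.+1 * phi ->
  #|[set t : {set G} * ({set G} * {set G}) |
     [&& d <= #|t.1|, d <= #|t.2.1|, d <= #|t.2.2| & zsf t.1 t.2.1 t.2.2]]|
  <= (#|[set S : {set G} | #|S| == d]| * #|[set T : {set G} | phi * #|T| <= #|G|]|) ^ 3
     * 2 ^ ((3 * (Q.+1 * #|G|)) %/ (2 * Q)).
Proof.
move=> Q0 phi0 dE.
(* The fingerprints are S1, T1 in A, S2, T2 in B and S3, T3 in C: S2 and T1 give
   containers for (A, C), S3 and T2 for (B, A), S1 and T3 for (C, B). *)
set E := [set S : {set G} | _]; set F := [set T : {set G} | _].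
pose P := finset.setX (finset.setX E (finset.setX E E)) (finset.setX F (finset.setX F F)).
pose cA (i : ({set G} * ({set G} * {set G})) * ({set G} * ({set G} * {set G}))) :=
  nearcover phi i.1.2.1 i.2.1 :&: ~: negsum i.2.2.1 i.1.2.2.
pose cB (i : ({set G} * ({set G} * {set G})) * ({set G} * ({set G} * {set G}))) :=
  nearcover phi i.1.2.2 i.2.2.1 :&: ~: negsum i.2.2.2 i.1.1.
pose cC (i : ({set G} * ({set G} * {set G})) * ({set G} * ({set G} * {set G}))) :=
  nearcover phi i.1.1 i.2.2.2 :&: ~: negsum i.2.1 i.1.2.1.
pose X i := finset.setX (powerset (cA i)) (finset.setX (powerset (cB i)) (powerset (cC i))).
have <- : #|P| = (#|E| * #|F|) ^ 3 by rewrite !cardsX; ring.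
apply: leq_trans (leq_card_bigcup_const (X := X) _) => [|i].
  apply/subset_leq_card/fintype.subsetP => -[A [B C]]; rewrite inE /=.
  case/and4P=> dA dB dC zABC.
  have [S1 sS1 cS1] := exists_subset_card dA.
  have [S2 sS2 cS2] := exists_subset_card dB.
  have [S3 sS3 cS3] := exists_subset_card dC.
  have zsub (A1 B1 C1 D : {set G}) : zsf A1 B1 C1 -> D \subset B1 -> zsf A1 D C1.
    move=> /zsfP H /fintype.subsetP sD; apply/zsfP => x y Ax /sD; exact: H.
  have [T1 [lT1 aT1 bT1]] := fingerprint phi0 (zsub _ _ _ _ zABC sS2).
  have zBCA : zsf B C A by rewrite zsfC23 zsfC12.
  have zCAB : zsf C A B by rewrite zsfC12 zsfC23.
  have [T2 [lT2 aT2 bT2]] := fingerprint phi0 (zsub _ _ _ _ zBCA sS3).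
  have [T3 [lT3 aT3 bT3]] := fingerprint phi0 (zsub _ _ _ _ zCAB sS1).
  apply/finset.bigcupP; exists ((S1, (S2, S3)), (T1, (T2, T3))).
    by rewrite !inE /= cS1 cS2 cS3 eqxx lT1 lT2 lT3.
  by rewrite !inE /= !finset.subsetI aT1 bT1 aT2 bT2 aT3 bT3.
case: i => [[S1 [S2 S3]] [T1 [T2 T3]]]; rewrite !inE /=.
case/andP=> /and3P[/eqP cS1 /eqP cS2 /eqP cS3] _.
rewrite !cardsX !card_powerset -!expnD leq_exp2l // leq_divRL ?muln_gt0 //.
have := container_size T1 phi0 (etrans cS2 dE).
have := container_size T2 phi0 (etrans cS3 dE).
have := container_size T3 phi0 (etrans cS1 dE).
rewrite /cA /cB /cC /=.
have IL (U V : {set G}) : #|U :&: V| <= #|U| by rewrite subset_leq_card ?finset.subsetIl.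
have IR (U V : {set G}) : #|U :&: V| <= #|V| by rewrite subset_leq_card ?finset.subsetIr.
set a1 := nearcover _ _ _; set a2 := ~: _; set a3 := nearcover _ _ _.
set a4 := ~: _; set a5 := nearcover _ _ _; set a6 := ~: _.
have := (IL a5 a4, IR a5 a4, (IL a3 a2, IR a3 a2), (IL a1 a6, IR a1 a6)).
move: #|a5 :&: a4| #|a3 :&: a2| #|a1 :&: a6| #|a1| #|a2| #|a3| #|a4| #|a5| #|a6|.
move: (Q.+1 * #|G|) => g.
move=> u v w n1 n2 n3 n4 n5 n6 [[[u1 u2] [v1 v2]] [w1 w2]] h1 h2 h3.
(* Each of A, B, C lies in the intersection of two containers, which has at most half their total
   size. *)
have : Q * (2 * (u + v + w)) <= Q * ((n1 + n2) + (n3 + n4) + (n5 + n6)).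
  by rewrite leq_mul2l; apply/orP; right; lia.
by rewrite !(mulnDr Q (_ + _)); lia.
Qed.

(** * Splitting by sizes, as pointwise inequalities between weights on triples *)

Definition wcount (G : finZmodType) (f : {set G} -> {set G} -> {set G} -> nat) : nat :=
  \sum_(A : {set G}) \sum_(B : {set G}) \sum_(C : {set G}) f A B C * zsf A B C.

Lemma wcount12 (G : finZmodType) (f : {set G} -> {set G} -> {set G} -> nat) :
  wcount f = wcount (fun A B C => f B A C).
Proof.
rewrite /wcount exchange_big; do 3!(apply: eq_bigr => ? _).
by rewrite zsfC12.
Qed.

Lemma wcount23 (G : finZmodType) (f : {set G} -> {set G} -> {set G} -> nat) :
  wcount f = wcount (fun A B C => f A C B).
Proof.
apply: eq_bigr => A _; rewrite exchange_big; do 2!(apply: eq_bigr => ? _).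
by rewrite zsfC23.
Qed.

Lemma wcountD (G : finZmodType) (f g : {set G} -> {set G} -> {set G} -> nat) :
  wcount (fun A B C => f A B C + g A B C) = wcount f + wcount g.
Proof.
rewrite /wcount -big_split; apply: eq_bigr => A _.
rewrite -big_split; apply: eq_bigr => B _.
by rewrite -big_split; apply: eq_bigr => C _; rewrite mulnDl.
Qed.

Lemma leq_wcount (G : finZmodType) (f g : {set G} -> {set G} -> {set G} -> nat) :
  (forall A B C, f A B C <= g A B C) -> wcount f <= wcount g.
Proof. by move=> H; do 3!(apply: leq_sum => ? _); rewrite leq_mul2r H orbT. Qed.

Lemma wcount_link (G : finZmodType) (q : pred {set G}) :
  wcount (fun A _ _ => q A) = \sum_(A : {set G} | q A) link A.
Proof.
rewrite [RHS]big_mkcond; apply: eq_bigr => A _; case: (q A).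
  by do 2!(apply: eq_bigr => ? _); rewrite mul1n.
by rewrite big1 // => B _; rewrite big1.
Qed.

Lemma wcount_sym (G : finZmodType) (q : pred {set G}) :
  wcount (fun A B C => q A + q B + q C) = 3 * \sum_(A : {set G} | q A) link A.
Proof.
rewrite !wcountD (wcount23 (fun _ _ C => q C : nat)).
by rewrite !(wcount12 (fun _ B _ => q B : nat)) wcount_link; lia.
Qed.

(** Once two members satisfy [q], the third is allowed to be any subset. *)
Lemma wcount_two (G : finZmodType) (q : pred {set G}) :
  wcount (fun A B C => q A * q B + q A * q C + q B * q C)
    <= 3 * (#|[set A | q A]| ^ 2 * 2 ^ #|G|).
Proof.
rewrite !wcountD (wcount12 (fun _ B C => q B * q C)).
rewrite !(wcount23 (fun A _ C => q A * q C)).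
suff : wcount (fun A B _ => q A * q B) <= #|[set A | q A]| ^ 2 * 2 ^ #|G| by lia.
have -> : #|[set A | q A]| = \sum_(A : {set G}) q A.
  by rewrite -sum1dep_card big_mkcond; apply: eq_bigr => A _; case: (q A).
have -> : 2 ^ #|G| = \sum_(C : {set G}) 1.
  by rewrite sum1_card -cardsT -(cardsT {set G}) -finset.powersetT card_powerset.
rewrite -mulnn big_distrl big_distrl; apply: leq_sum => A _ /=.
rewrite -mulnA big_distrl big_distrr; apply: leq_sum => B _ /=.
rewrite mulnA big_distrr; apply: leq_sum => C _ /=.
by rewrite leq_mul2l leq_b1 orbT.
Qed.

Definition large_triples (G : finZmodType) d :=
  [set t : {set G} * ({set G} * {set G}) |
     [&& d <= #|t.1|, d <= #|t.2.1|, d <= #|t.2.2| & zsf t.1 t.2.1 t.2.2]].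

Lemma wcount_large (G : finZmodType) d :
  wcount (fun A B C : {set G} => (d <= #|A|) && (d <= #|B|) && (d <= #|C|)) =
  #|large_triples G d|.
Proof.
rewrite -sum1_card big_mkcond /wcount.
pose f (A : {set G}) (p : {set G} * {set G}) : nat :=
  ((d <= #|A|) && (d <= #|p.1|) && (d <= #|p.2|)) * zsf A p.1 p.2.
transitivity (\sum_A \sum_p f A p); first by apply: eq_bigr => A _; rewrite pair_bigA.
rewrite pair_bigA; apply: eq_bigr => -[A [B C]] _; rewrite inE /=.
by rewrite /f /=; case: (d <= #|A|); case: (d <= #|B|); case: (d <= #|C|); case: zsf.
Qed.

Lemma triple_count_wcount (G : finZmodType) :
  triple_count G = wcount (fun _ _ _ : {set G} => 1).
Proof. by rewrite triple_countE; do 3!(apply: eq_bigr => ? _); rewrite mul1n. Qed.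

(** Either some member has size at most 1, or some member has size between 2 and d, or all three are
    large. *)
Lemma triple_count_upper (G : finZmodType) d :
  triple_count G <=
    3 * (4 ^ #|G| + #|G| * 3 ^ #|G|)
    + 3 * \sum_(A : {set G} | 1 < #|A| <= d) link A + #|large_triples G d|.
Proof.
rewrite -sum_link_small -wcount_large -!wcount_sym -!wcountD triple_count_wcount.
by apply: leq_wcount => A B C; do 3!case: (ltnP 1 #|_|) => ?; lia.
Qed.

(** Bonferroni: if i of the three members have size at most 1, then i <= 1 + i(i - 1)/2. *)
Lemma triple_count_lower (G : finZmodType) :
  3 * (4 ^ #|G| + #|G| * 3 ^ #|G|) <=
    triple_count G + 3 * (#|[set A : {set G} | #|A| <= 1]| ^ 2 * 2 ^ #|G|).
Proof.
rewrite -sum_link_small -wcount_sym triple_count_wcount.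
apply: leq_trans (_ : _ <= wcount _ + wcount _) (leq_add (leqnn _) (wcount_two _)).
rewrite -wcountD; apply: leq_wcount => A B C.
by do 3!case: (#|_| <= 1).
Qed.

Local Open Scope ring_scope.

(** * Exponential estimates over the reals *)

Lemma bernoulli_ler (R : realFieldType) (x : R) n : 0 <= x -> 1 + n%:R * x <= (1 + x) ^+ n.
Proof.
move=> x0; elim: n => [|n IHn]; first by rewrite expr0 mul0r addr0.
rewrite exprS -natr1; have n0 : 0 <= n%:R :> R by [].
have x1 : 0 <= 1 + x by rewrite addr_ge0.
apply: le_trans (ler_wpM2l x1 IHn).
by have := mulr_ge0 n0 (mulr_ge0 x0 x0); nra.
Qed.

(** This trades factors 2 for powers of 1 + 1/Q, the common base of all the losses. *)
Lemma ler2_exp (R : realFieldType) Q : (0 < Q)%N -> 2 <= (1 + Q%:R^-1) ^+ Q :> R.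
Proof.
move=> Q0; have Q0R : 0 < Q%:R :> R by rewrite ltr0n.
have := bernoulli_ler Q (_ : 0 <= Q%:R^-1 :> R).
by rewrite divff ?gt_eqF // invr_ge0 ltW //; apply.
Qed.

Lemma card_small_sets_real (R : realFieldType) (T : finType) m k : (0 < m)%N ->
  #|[set B : {set T} | (#|B| <= k)%N]|%:R <= m%:R ^+ k * (1 + m%:R^-1) ^+ #|T| :> R.
Proof.
move=> m0; have m0R : 0 < m%:R :> R by rewrite ltr0n.
rewrite -(ler_pM2r (exprn_gt0 #|T| m0R)) -mulrA -exprMn mulrDl mul1r mulVf ?gt_eqF //.
by rewrite natr1 -!natrX -!natrM ler_nat card_small_sets.
Qed.

(** Sets of size at most t = N/(Qp), rounded down, number at most Q^t (1 + 1/Q)^N. As Q = 2^p, Q^t =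
    2^(pt) <= (1 + 1/Q)^(Qpt) <= (1 + 1/Q)^N. *)
Lemma card_fingerprints (R : realFieldType) (T : finType) p Q :
  (0 < p)%N -> Q = (2 ^ p)%N ->
  #|[set B : {set T} | (Q * p * #|B| <= #|T|)%N]|%:R <= (1 + Q%:R^-1) ^+ (2 * #|T|) :> R.
Proof.
move=> p0 QE; have Q0 : (0 < Q)%N by rewrite QE expn_gt0.
have Q0R : 0 < Q%:R :> R by rewrite ltr0n.
set t := (#|T| %/ (Q * p))%N.
have le1 : 1 <= 1 + Q%:R^-1 :> R by rewrite lerDl invr_ge0 ltW.
have -> : [set B : {set T} | (Q * p * #|B| <= #|T|)%N] = [set B : {set T} | (#|B| <= t)%N].
  by apply/setP => B; rewrite !inE leq_divRL ?muln_gt0 ?Q0 // mulnC.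
apply: le_trans (card_small_sets_real _ _ _ Q0) _.
rewrite mul2n -addnn exprD ler_pM2r ?exprn_gt0 ?(lt_le_trans ltr01) //.
have two := ler2_exp R Q0.
rewrite {1}QE natrX -exprM.
apply: le_trans (_ : ((1 + Q%:R^-1) ^+ Q) ^+ (p * t) <= _).
  by rewrite lerXn2r // nnegrE ?exprn_ge0 // (le_trans ler01).
by rewrite -exprM ler_weXn2l // mulnA mulnC leq_divM.
Qed.

Lemma pow2_container_bound (R : realFieldType) Q N (g : R) : (0 < Q)%N ->
  0 <= g -> 8 * (1 + Q%:R^-1) ^+ 3 <= g ^+ 2 ->
  2 ^+ ((3 * (Q.+1 * N)) %/ (2 * Q)) <= g ^+ N.
Proof.
move=> Q0 g0 leg; set s := (_ %/ _)%N.
have Q0R : 0 < Q%:R :> R by rewrite ltr0n.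
have le1 : 1 <= 1 + Q%:R^-1 :> R by rewrite lerDl invr_ge0 ltW.
have two := ler2_exp R Q0.
have sle : (s * (2 * Q) <= 3 * (Q.+1 * N))%N by apply: leq_divM.
(* After squaring, j is the excess of the exponent over 3N; it costs 2^j <= (1 + 1/Q)^(Qj) <= (1 +
   1/Q)^(3N). *)
have [j [sj Qj]] : exists j, (2 * s <= 3 * N + j /\ Q * j <= 3 * N)%N.
  exists (2 * s - 3 * N)%N; split; first by lia.
  by rewrite mulnBr; nia.
rewrite -(ler_pXn2r (n := 2)) ?nnegrE ?exprn_ge0 //.
rewrite -!exprM [(N * 2)%N]mulnC (exprM g).
apply: le_trans (_ : 2 ^+ (3 * N + j) <= _); first by rewrite ler_weXn2l ?ler1n // mulnC.
apply: le_trans (_ : (8 * (1 + Q%:R^-1) ^+ 3) ^+ N <= _); last first.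
  by rewrite lerXn2r // nnegrE ?exprn_ge0 ?mulr_ge0 ?exprn_ge0 // (le_trans ler01).
rewrite exprD exprMn (exprM _ 3 N) (_ : 2 ^+ 3 = 8); last by rewrite -natrX.
rewrite ler_pM2l ?exprn_gt0 //.
apply: le_trans (_ : ((1 + Q%:R^-1) ^+ Q) ^+ j <= _).
  by rewrite lerXn2r // nnegrE ?exprn_ge0 // (le_trans ler01).
by rewrite -!exprM ler_weXn2l.
Qed.

Lemma link_middle (R : realFieldType) (G : finZmodType) Q d (h : R) : (0 < Q)%N ->
  0 <= h -> 24 <= h ^+ 3 ->
  (\sum_(A : {set G} | (1 < #|A| <= d)%N) link A)%:R <=
    Q%:R ^+ d * ((1 + Q%:R^-1) * h) ^+ #|G|.
Proof.
move=> Q0 h0 leh.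
have leA (A : {set G}) : (1 < #|A|)%N -> (link A)%:R <= h ^+ #|G|.
  case/card_gt1P => x [y [Ax Ay xy]].
  apply: le_trans (_ : (link [set x; y])%:R <= _).
    by rewrite ler_nat linkS //; apply/fintype.subsetP => z /set2P[]->.
  rewrite -(ler_pXn2r (n := 3)) ?nnegrE ?exprn_ge0 // -(exprM h) mulnC (exprM h).
  apply: le_trans (_ : 24 ^+ #|G| <= _); last by rewrite lerXn2r ?nnegrE ?exprn_ge0.
  by rewrite -!natrX ler_nat link2.
rewrite exprMn mulrA.
apply: le_trans (ler_wpM2r (exprn_ge0 _ h0) (card_small_sets_real _ _ _ Q0)).
rewrite natr_sum mulr_natl -sum1dep_card -sumrMnr.
rewrite [leLHS]big_mkcond [leRHS]big_mkcond; apply: ler_sum => A _.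
case: ifP => [/andP[A1 ->]|_]; first by rewrite mulr1n leA.
by case: ifP => // _; rewrite mulr1n exprn_ge0.
Qed.

Lemma large_triples_bound (R : realFieldType) (G : finZmodType) p Q d (g : R) :
  (0 < p)%N -> Q = (2 ^ p)%N -> d = (Q.+1 * (Q * p))%N ->
  0 <= g -> 8 * (1 + Q%:R^-1) ^+ 3 <= g ^+ 2 ->
  #|large_triples G d|%:R <=
    (Q%:R ^+ d) ^+ 3 * ((1 + Q%:R^-1) ^+ 9 * g) ^+ #|G|.
Proof.
move=> p0 QE dE g0 leg; have Q0 : (0 < Q)%N by rewrite QE expn_gt0.
have phi0 : (0 < Q * p)%N by rewrite muln_gt0 Q0.
have a0 : 0 <= 1 + Q%:R^-1 :> R by rewrite addr_ge0 // invr_ge0.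
apply: le_trans (_ : (_ : nat)%:R <= _).
  by rewrite ler_nat; exact: card_large_triples Q0 phi0 dE.
rewrite natrM !natrX natrM [X in _ <= _ * X]exprMn [leRHS]mulrA.
apply: ler_pM (pow2_container_bound _ Q0 g0 leg) => //;
  [by rewrite exprn_ge0 // mulr_ge0|by rewrite exprn_ge0|].
(* The 9 is 3(1 + 2): for each of the three pairs, one power for the d-subset and two for the
   fingerprint. *)
have cube (a : R) : (a ^+ 9) ^+ #|G| = (a ^+ (#|G| + 2 * #|G|)) ^+ 3.
  by rewrite -!exprM; congr (_ ^+ _); lia.
rewrite cube.
rewrite -exprMn lerXn2r ?nnegrE ?mulr_ge0 ?exprn_ge0 //.
rewrite exprD mulrA ler_pM ?card_fingerprints //.
apply: le_trans (card_small_sets_real R G d Q0).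
by rewrite ler_nat subset_leq_card //; apply/fintype.subsetP => S; rewrite !inE => /eqP->.
Qed.

Theorem theorem16 (R : realType) :
  exists (c K : R), 0 < c /\ 0 < K /\
    forall G : finZmodType,
      `| (triple_count G)%:R - 3 * 4 ^+ #|G| - 3 * (#|G|)%:R * 3 ^+ #|G| |
        <= K * (3 - c) ^+ #|G|.
Proof.
(* Q and d stay abstract, lest the unary numeral d be computed. *)
have [Q [d [dE QE]]] : exists Q d, d = (Q.+1 * (Q * 8))%N /\ Q = (2 ^ 8)%N by do 2!eexists.
have Q0 : (0 < Q)%N by rewrite QE.
(* Here 289/100 exceeds the cube root of 24 and (285/100)^2 exceeds 8 (257/256)^3. The rates
   (257/256)(289/100), (257/256)^9 (285/100) and 2 (6/5)^2 are all below b. *)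
pose b : R := 149 / 50.
have aE : 1 + Q%:R^-1 = 257 / 256 :> R by rewrite QE natrX; lra.
pose D : R := Q%:R ^+ d.
have D0 : 0 <= D by rewrite exprn_ge0.
(* In K, 75 = 3 * 25 pays for the double counting, 3D for the members of middle size and D^3 for the
   large triples. *)
exists (1 / 50), (75 + 3 * D + D ^+ 3); split; first by lra.
split; first by have := exprn_ge0 3 D0; lra.
move=> G; have -> : 3 - 1 / 50 = b by rewrite /b; lra.
have b0 : 0 <= b by rewrite /b; lra.
have mid : (\sum_(A : {set G} | (1 < #|A| <= d)%N) link A)%:R <= D * b ^+ #|G|.
  apply: le_trans (@link_middle R G Q d (289 / 100) Q0 _ _) _; [by lra|by lra|].
  by rewrite ler_wpM2l // lerXn2r ?nnegrE // aE /b; lra.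
have large : #|large_triples G d|%:R <= D ^+ 3 * b ^+ #|G|.
  apply: le_trans (@large_triples_bound R G 8 Q d (285 / 100) _ QE dE _ _) _ => //;
    [by lra|by rewrite aE; lra|].
  by rewrite ler_wpM2l ?exprn_ge0 // lerXn2r ?nnegrE // aE /b; lra.
have two : (#|[set A : {set G} | (#|A| <= 1)%N]| ^ 2 * 2 ^ #|G|)%:R <= 25 * b ^+ #|G|.
  have le5 := card_small_sets_real R G 1 (isT : 0 < 5)%N.
  rewrite natrM !natrX.
  apply: le_trans (_ : (5 * (6 / 5) ^+ #|G|) ^+ 2 * 2 ^+ #|G| <= _).
    rewrite ler_wpM2r ?exprn_ge0 // lerXn2r ?nnegrE ?mulr_ge0 ?exprn_ge0 //.
      by lra.
    by rewrite expr1 (_ : 1 + 5%:R^-1 = 6 / 5) in le5; last by lra.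
  rewrite exprMn -mulrA -exprM mulnC exprM -exprMn.
  apply: ler_pM; rewrite ?exprn_ge0 //; [by lra|by lra|].
  by rewrite lerXn2r ?nnegrE // /b; lra.
have bN0 := exprn_ge0 #|G| b0.
have DbN0 := mulr_ge0 D0 bN0; have D3bN0 := mulr_ge0 (exprn_ge0 3 D0) bN0.
have := triple_count_upper G d; have := triple_count_lower G.
rewrite -!(ler_nat R) !(natrD, natrM _ 3) [(#|G| * _)%:R]natrM 2!natrX.
move: two mid large; set u := (_ * _)%:R; set v := (bigop.body _ _ _)%:R; set w := #|_|%:R.
move=> *; rewrite ler_norml; apply/andP; split; lra.
Qed.
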